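(* Let $X$ and $Y$ be Banach spaces and $1<p<\infty$. If $X$ and $Y$ both have the Daugavet property, then $$\mathcal T^s(X\oplus_p Y)=\mathcal T(X\oplus_p Y)=\mathcal T^{cc}(X\oplus_p Y)=2^{1/p}.$$
   Context: All Banach spaces are nontrivial and real. $B_X$ and $S_X$ denote the closed unit ball and the unit sphere of $X$, $X^*$ is the dual, and $B(x,r)$ is the ball with center $x$ and radius $r$. $X\oplus_p Y$ is $X\times Y$ with the norm $\|(x,y)\|=(\|x\|^p+\|y\|^p)^{1/p}$. A Banach space $X$ has the Daugavet property if $\|I+T\|=1+\|T\|$ for every rank-one bounded linear operator $T:X\to X$. A slice of $B_X$ is a set $S(B_X,x^*,\alpha)=\{x\in B_X: x^*(x)>1-\alpha\}$ with $x^*\in S_{X^*}$ and $\alpha>0$. A convex combination of subsets $W_1,\dots,W_n$ of $B_X$ is a set $\sum_{i=1}^n\lambda_iW_i=\{\sum_i\lambda_iw_i: w_i\in W_i\}$ with $n\in\mathbb N$, $\lambda_i\in[0,1]$, $\sum_{i=1}^n\lambda_i=1$. The Daugavet indices of thickness are: - $\mathcal T^s(X)=\inf\{r>0:$ there exist $x\in S_X$ and a slice $S$ of $B_X$ such that $S\subset B(x,r)\}$; - $\mathcal T(X)=\inf\{r>0:$ there exist $x\in S_X$ and a relatively weakly open subset $W$ of $B_X$ such that $\emptyset\ne W\subset B(x,r)\}$; - $\mathcal T^{cc}(X)=\inf\{r>0:$ there exist $x\in S_X$ and a convex combination $C$ of relatively weakly open subsets of $B_X$ such that $\emptyset\ne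 C\subset B(x,r)\}$. *)

(* Defs.v *)
From HB Require Import structures.
From mathcomp Require Import all_boot all_order all_algebra.
From mathcomp Require Import all_classical all_reals all_analysis.
From mathcomp Require Import ring.
Set Implicit Arguments.
Unset Strict Implicit.
Unset Printing Implicit Defensive.
Import Order.TTheory GRing.Theory Num.Def Num.Theory.
Import numFieldNormedType.Exports.
Local Open Scope classical_set_scope.
Local Open Scope ring_scope.

(* An alias of [X * Y], whose library norm is the maximum norm.  The proof of
   [1 < p] is a parameter because the triangle inequality needs it. *)
Definition psum (R : realType) (p : R) (p1 : 1 < p) (X Y : normedModType R) :
  Type := (X * Y)%type.

Section psum_norm.
Context (R : realType) (p : R) (p1 : 1 < p) (X Y : normedModType R).

HB.instance Definition _ := GRing.Lmodule.copy (psum p1 X Y) (X * Y)%type.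

Definition psum_norm (u : psum p1 X Y) : R :=
  (`|u.1| `^ p + `|u.2| `^ p) `^ p^-1.

Let p_gt0 : 0 < p. Proof. exact: lt_trans p1. Qed.
Let p_neq0 : p != 0. Proof. exact: lt0r_neq0. Qed.

Let psum_norm_ge0 u : 0 <= psum_norm u.
Proof. exact: powR_ge0. Qed.

Let psum_normX u : psum_norm u `^ p = `|u.1| `^ p + `|u.2| `^ p.
Proof. by rewrite -powRrM mulVf// powRr1// addr_ge0// powR_ge0. Qed.

Let psum_norm_eq0 u : psum_norm u = 0 -> u = 0.
Proof.
move=> u0; have := psum_normX u; rewrite u0 powR0// => /esym/eqP.
rewrite paddr_eq0 ?powR_ge0// !powR_eq0 !normr_eq0 p_neq0 !andbT.
by case: u {u0} => a b /= /andP[/eqP -> /eqP ->].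
Qed.

Let powR_convex (t a b : R) : 0 <= t <= 1 -> 0 <= a -> 0 <= b ->
  (t * a + (1 - t) * b) `^ p <= t * a `^ p + (1 - t) * b `^ p.
Proof.
move=> /andP[t0 t1] a0 b0.
have := @convex_powR R p (ltW p1) (Itv01 t0 t1) a b.
by rewrite /= !inE /= !in_itv /= !andbT => /(_ a0 b0).
Qed.

Let psum_normD u v : psum_norm (u + v) <= psum_norm u + psum_norm v.
Proof.
have [/psum_norm_eq0 ->|u0] := eqVneq (psum_norm u) 0.
  by rewrite add0r lerDr psum_norm_ge0.
have [/psum_norm_eq0 ->|v0] := eqVneq (psum_norm v) 0.
  by rewrite addr0 lerDl psum_norm_ge0.
have {u0}A0 : 0 < psum_norm u by rewrite lt0r u0 psum_norm_ge0.
have {v0}B0 : 0 < psum_norm v by rewrite lt0r v0 psum_norm_ge0.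
have := psum_normX u; have := psum_normX v; have := psum_normX (u + v).
move: (psum_norm_ge0 (u + v)) A0 B0.
move: (psum_norm u) (psum_norm v) (psum_norm (u + v)) => A B C.
case: u => x y; case: v => x' y' /= C0 A0 B0 CE BE AE.
have AB0 : 0 < A + B by rewrite addr_gt0.
pose t := A / (A + B).
have t01 : 0 <= t <= 1.
  apply/andP; split; first by rewrite divr_ge0 ?(ltW A0) ?(ltW AB0).
  by rewrite ler_pdivrMr// mul1r lerDl ltW.
have key (a b c : R) : 0 <= a -> 0 <= b -> 0 <= c -> c <= a + b ->
    c `^ p <= (A + B) `^ p * (t * (a `^ p / A `^ p) + (1 - t) * (b `^ p / B `^ p)).
  move=> a0 b0 c0 cab.
  have VA0 : 0 <= A^-1 by rewrite invr_ge0 ltW.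
  have VB0 : 0 <= B^-1 by rewrite invr_ge0 ltW.
  have powRV' (d : R) : 0 < d -> (d `^ p)^-1 = d^-1 `^ p.
    by move=> d0; rewrite -powR_inv1 ?powR_ge0// powRAC powR_inv1// ltW.
  rewrite !powRV'// -!powRM//.
  apply: (@le_trans _ _ ((A + B) `^ p * (t * (a / A) + (1 - t) * (b / B)) `^ p)).
    have tab0 : 0 <= t * (a / A) + (1 - t) * (b / B).
      case/andP: t01 => t0 t1; have tc0 : 0 <= 1 - t by rewrite subr_ge0.
      exact: addr_ge0 (mulr_ge0 t0 (mulr_ge0 a0 VA0))
                      (mulr_ge0 tc0 (mulr_ge0 b0 VB0)).
    rewrite -(powRM p (ltW AB0) tab0).
    rewrite (_ : (A + B) * _ = a + b); last first.
      by rewrite /t; field; rewrite !lt0r_neq0.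
    by rewrite ge0_ler_powR ?nnegrE ?addr_ge0 ?(ltW p_gt0).
  rewrite ler_wpM2l ?powR_ge0//.
  by apply: powR_convex => //; rewrite mulr_ge0.
suff : C `^ p <= (A + B) `^ p.
  apply: contraTle => ABC; rewrite -ltNge.
  by rewrite gt0_ltr_powR ?nnegrE ?(ltW AB0).
rewrite CE.
apply: le_trans (lerD (key _ _ _ _ _ _ (ler_normD x x'))
                      (key _ _ _ _ _ _ (ler_normD y y'))) _; rewrite ?normr_ge0//.
have Ap0 : A `^ p != 0 by rewrite lt0r_neq0// powR_gt0.
have Bp0 : B `^ p != 0 by rewrite lt0r_neq0// powR_gt0.
rewrite -mulrDr addrACA -!mulrDr -!mulrDl -AE -BE !divff// !mulr1.
by rewrite addrC subrK mulr1.
Qed.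

Let psum_normZ (l : R) u : psum_norm (l *: u) = `|l| * psum_norm u.
Proof.
rewrite /psum_norm /= !normrZ !powRM// -mulrDr powRM ?addr_ge0 ?powR_ge0//.
by rewrite -powRrM mulfV// powRr1.
Qed.

HB.instance Definition _ := @Lmodule_isNormed.Build R (psum p1 X Y) psum_norm
  psum_normD psum_normZ psum_norm_eq0.

Lemma psum_normE (u : psum p1 X Y) :
  `|u| = (`|u.1| `^ p + `|u.2| `^ p) `^ p^-1.
Proof. by []. Qed.

End psum_norm.

Definition unit_ball (R : realType) (X : normedModType R) : set X :=
  closed_ball 0 1.
Arguments unit_ball {R} X _ /.

Definition unit_sphere (R : realType) (X : normedModType R) : set X :=
  [set x | `|x| = 1].
Arguments unit_sphere {R} X _ /.

Definition opnorm (R : realType) (V W : normedModType R) (T : V -> W) : R :=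
  sup [set `|T x| | x in unit_ball V].

Definition rank_one (R : realType) (V W : normedModType R) (T : V -> W) : Prop :=
  exists2 y : W, y != 0 & range T = [set c *: y | c in [set: R]].

Definition daugavet_property (R : realType) (X : normedModType R) : Prop :=
  forall T : {linear X -> X}, bounded_near T (nbhs 0) -> rank_one T ->
    opnorm (fun x => x + T x) = 1 + opnorm T.

Definition dual (R : realType) (X : normedModType R) :
  set {linear X -> R^o} := [set f | continuous f].
Arguments dual {R} X _ /.

Definition dual_sphere (R : realType) (X : normedModType R) :
  set {linear X -> R^o} := [set f | dual X f /\ opnorm f = 1].
Arguments dual_sphere {R} X _ /.

(* [X] with its weak topology, the initial topology of the maps in the dual. *)
Definition weak (R : realType) (X : normedModType R) : Type :=
  sup_topology (fun f : {f : {linear X -> R^o} | dual X f} =>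
    Topological.on (initial_topology (sval f : X -> R^o))).

HB.instance Definition _ (R : realType) (X : normedModType R) :=
  Topological.on (weak X).

Definition weakly_open (R : realType) (X : normedModType R) (U : set X) : Prop :=
  @open (weak X) U.

Definition slice (R : realType) (X : normedModType R) (f : {linear X -> R^o})
  (a : R) : set X := [set x | unit_ball X x /\ f x > 1 - a].

Definition slices (R : realType) (X : normedModType R) : set (set X) :=
  [set S | exists2 f, dual_sphere X f & exists2 a, 0 < a & S = slice f a].
Arguments slices {R} X _ /.

Definition rel_weakly_open (R : realType) (X : normedModType R) : set (set X) :=
  [set W | exists2 U, weakly_open U & W = U `&` unit_ball X].
Arguments rel_weakly_open {R} X _ /.

Definition convex_combinations (R : realType) (X : normedModType R)
    (F : set (set X)) : set (set X) :=
  [set C | exists (n : nat) (l : 'I_n -> R) (W : 'I_n -> set X),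
    [/\ forall i, 0 <= l i <= 1,
        \sum_i l i = 1,
        forall i, F (W i) &
        C = [set \sum_i l i *: w i | w in [set w | forall i, W i (w i)]]]].

(* Closed balls here; open balls give the same infimum. *)
Definition thickness (R : realType) (X : normedModType R) (F : set (set X)) : R :=
  inf [set r | 0 < r /\ exists2 x, unit_sphere X x &
                        exists2 A, F A & A `<=` closed_ball x r].

Definition thickness_s (R : realType) (X : normedModType R) : R :=
  thickness (slices X).

Definition thickness_w (R : realType) (X : normedModType R) : R :=
  thickness [set W | rel_weakly_open X W /\ W !=set0].

Definition thickness_cc (R : realType) (X : normedModType R) : R :=
  thickness [set C | convex_combinations (rel_weakly_open X) C /\ C !=set0].

(* Main.v *)
(* A thin slice of the unit ball of the p-sum [Z] defined by a functional on [X]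
   consists of pairs with small second component, hence lies in a ball of radius
   close to [2^(1/p)] around any [(0, y)] with [|y| = 1].

   Conversely, convexity of [t^p] gives [|z| >= 2^(1/p) (|z.1| + |z.2|) / 2] on [Z],
   so it suffices that every nonempty convex combination of relatively weakly open
   sets contains points at l1-distance almost [2] from a given unit vector [z0].
   In a Daugavet space, a point of the [r]-ball can be moved inside any of its weak
   neighborhoods, staying in the [r]-ball, so that its distance to a given [y] is
   almost [r + |y|].  For slices this is the Daugavet equation of a rank-one
   operator.  For finitely many functionals [f_j], average points chosen one after
   the other, each in a half-space that keeps the accumulated error in the [f_j]
   small, and each almost maximally far from what remains of [y].  The same
   one-by-one choice handles convex combinations.  A point [(a, b)] of a relatively
   weakly open set is replaced by [(u, v)] with [|u| <= (1 - |b|^p)^(1/p)] and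
   [|v| <= |b|]; these two radii have sum at least [1], and so have the norms of
   the components of [z0]. *)
From HB Require Import structures.
Require Import Defs.
From mathcomp Require Import all_boot all_order all_algebra.
From mathcomp Require Import all_classical all_reals all_analysis.
From mathcomp Require Import ring lra.
Set Implicit Arguments.
Unset Strict Implicit.
Unset Printing Implicit Defensive.
Import Order.TTheory GRing.Theory Num.Theory.
Import numFieldNormedType.Exports.
Local Open Scope classical_set_scope.
Local Open Scope ring_scope.

(** * Hahn-Banach through minimal sublinear functionals *)
Section minimal_gauge.
Context (R : realType) (X : normedModType R).
Implicit Types (q : X -> R) (x y : X) (t : R).

(** Sublinear functionals dominated by the norm. Homogeneity is asked as one inequality for positive
    scalars, which is easy to check on infima; applying it to the inverse scalar turns it into the
    equality [gaugeZ]. *)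
Definition gauge q : Prop :=
  [/\ forall x y, q (x + y) <= q x + q y,
      forall t x, 0 < t -> q (t *: x) <= t * q x &
      forall x, q x <= `|x|].

Lemma gauge_normr : gauge (fun x => `|x|).
Proof.
split=> // [x y|t x t0]; first exact: ler_normD.
by rewrite normrZ gtr0_norm.
Qed.

Lemma gauge0 q : gauge q -> q 0 = 0.
Proof.
case=> qD qZ qN; apply: le_anti; apply/andP; split.
  by rewrite -[leRHS](@normr0 _ X).
by have := qD 0 0; rewrite addr0; lra.
Qed.

Lemma gaugeN q x : gauge q -> - q (- x) <= q x.
Proof.
by move=> gq; have [qD _ _] := gq; have := qD x (- x); rewrite subrr gauge0//; lra.
Qed.

Lemma gauge_norm_ge q x : gauge q -> - `|x| <= q x.
Proof.
move=> gq; apply: le_trans (gaugeN x gq); rewrite lerN2 -normrN.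
by case: gq.
Qed.

Lemma gaugeZ q t x : gauge q -> 0 <= t -> q (t *: x) = t * q x.
Proof.
move=> gq; have [_ qZ _] := gq.
rewrite le_eqVlt => /predU1P[<-|t0]; first by rewrite scale0r mul0r gauge0.
apply: le_anti; rewrite qZ//=.
have tV0 : 0 < t^-1 by rewrite invr_gt0.
have := qZ _ (t *: x) tV0; rewrite scalerA mulVf ?gt_eqF// scale1r.
by rewrite ler_pdivlMl.
Qed.

(* The largest sublinear functional below [q] whose value at [- y] is at most
   [- q y]; a [q] that it lowers for no [y] is additive. *)
Definition gauge_step q y x : R :=
  inf [set q (x + t *: y) - t * q y | t in [set t | 0 <= t]].

Lemma gauge_step_le q y x t : gauge q -> 0 <= t ->
  gauge_step q y x <= q (x + t *: y) - t * q y.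
Proof.
move=> gq t0; have [qD _ _] := gq; apply: ge_inf; last by exists t.
exists (- q (- x)) => _ [s /= s0 <-].
by have := qD (- x) (x + s *: y); rewrite addKr gaugeZ//; lra.
Qed.

Lemma le_gauge_step q y x c :
  (forall t, 0 <= t -> c <= q (x + t *: y) - t * q y) ->
  c <= gauge_step q y x.
Proof.
move=> H; apply: lb_le_inf; first by exists (q (x + 0 *: y) - 0 * q y), 0 => /=.
by move=> _ [t /= t0 <-]; exact: H.
Qed.

Lemma gauge_step_le_id q y x : gauge q -> gauge_step q y x <= q x.
Proof.
move=> /(gauge_step_le y x) /(_ (lexx _)).
by rewrite scale0r addr0 mul0r subr0.
Qed.

Lemma gauge_gauge_step q y : gauge q -> gauge (gauge_step q y).
Proof.
move=> gq; have [qD qZ qN] := gq; split.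
- move=> x x'; rewrite -lerBlDr; apply: le_gauge_step => s s0.
  rewrite lerBlDl -lerBlDr; apply: le_gauge_step => t t0.
  rewrite lerBlDl; apply: le_trans (gauge_step_le y _ gq (addr_ge0 s0 t0)) _.
  have := qD (x + s *: y) (x' + t *: y).
  by rewrite addrACA -scalerDl; lra.
- move=> t x t0; rewrite -ler_pdivrMl//; apply: le_gauge_step => s s0.
  rewrite ler_pdivrMl//.
  have ts0 : 0 <= t * s by rewrite mulr_ge0// ltW.
  apply: le_trans (gauge_step_le y _ gq ts0) _.
  by rewrite -scalerA -scalerDr gaugeZ ?(ltW t0)// -mulrA -mulrBr.
- by move=> x; apply: le_trans (gauge_step_le_id y x gq) (qN x).
Qed.

(** This is the lower bound of a chain needed for Zorn. Subadditivity survives because, of two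
    members used at [x] and at [y], the smaller one serves for both. *)
Lemma inf_gauge_chain (A : set (X -> R)) : A !=set0 -> A `<=` gauge ->
  (forall q q', A q -> A q' ->
    (forall x, q x <= q' x) \/ (forall x, q' x <= q x)) ->
  gauge (fun x => inf [set q x | q in A]) /\
  forall q x, A q -> inf [set q x | q in A] <= q x.
Proof.
move=> [q0 Aq0] Ag Atot.
have infle q x : A q -> inf [set q x | q in A] <= q x.
  move=> Aq; apply: ge_inf; last by exists q.
  by exists (- `|x|) => _ [s As <-]; exact: gauge_norm_ge _ (Ag _ As).
have leinf c x : (forall q, A q -> c <= q x) -> c <= inf [set q x | q in A].
  move=> H; apply: lb_le_inf; first by exists (q0 x), q0.
  by move=> _ [s As <-]; exact: H.
split=> //; split.
- move=> x y; rewrite -lerBlDr; apply: (leinf _ x) => s As.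
  rewrite lerBlDl -lerBlDr; apply: (leinf _ y) => s' As'; rewrite lerBlDl.
  case: (Atot s s' As As') => ss'.
    apply: le_trans (infle s _ As) _; have [qD _ _] := Ag _ As.
    by apply: le_trans (qD _ _) _; rewrite lerD2l ss'.
  apply: le_trans (infle s' _ As') _; have [qD _ _] := Ag _ As'.
  by apply: le_trans (qD _ _) _; rewrite lerD2r ss'.
- move=> t x t0; rewrite -ler_pdivrMl//; apply: (leinf _ x) => s As.
  rewrite ler_pdivrMl//; apply: le_trans (infle s _ As) _.
  by have [_ + _] := Ag _ As; apply.
- by move=> x; apply: le_trans (infle _ x Aq0) _; have [] := Ag _ Aq0.
Qed.

Lemma minimal_gauge q : gauge q -> exists q', [/\ gauge q',
  forall x, q' x <= q x &
  forall r, gauge r -> (forall x, r x <= q' x) -> r = q'].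
Proof.
move=> gq.
pose T := {r : X -> R | gauge r /\ forall x, r x <= q x}.
(* The order is reversed, so a maximal element for [leT] is a minimal gauge. *)
pose leT (r s : T) := `[< forall x, sval s x <= sval r x >].
have [t|r s t /asboolP rs /asboolP st|[r ?] [s ?] /asboolP /= rs /asboolP /= sr|
  A Atot|[r [gr rq]] rmin] := @Zorn T leT.
- by apply/asboolP.
- by apply/asboolP => x; exact: le_trans (st x) (rs x).
- by apply: eq_exist; apply/funext => x; apply: le_anti; rewrite rs sr.
- have [/eqP ->|/set0P[[r0 [gr0 r0q]] Ar0]] := boolP (A == set0).
    by exists (exist _ q (conj gq (fun x => lexx _))).
  have [||r s|gB Ble] := @inf_gauge_chain [set sval r | r in A].
  + by exists r0; exists (exist _ r0 (conj gr0 r0q)).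
  + by move=> _ [[s []] /= gs _ _ <-].
  + move=> [s' As' <-] [t' At' <-].
    by case: (Atot s' t' As' At') => /asboolP; [right|left].
  have Bq x : inf [set r x | r in [set sval r | r in A]] <= q x.
    by apply: le_trans (r0q x); apply: Ble; exists (exist _ r0 (conj gr0 r0q)).
  exists (exist (fun r => gauge r /\ forall x, r x <= q x) _ (conj gB Bq)).
  move=> s As; apply/asboolP => x /=.
  by apply: Ble; exists s.
- exists r; split=> // s gs sr.
  have sq x : s x <= q x by exact: le_trans (sr x) (rq x).
  pose t : T := exist (fun r => gauge r /\ forall x, r x <= q x) s (conj gs sq).
  by apply: (congr1 sval (rmin t _)); apply/asboolP.
Qed.

Lemma dual_neq0 x : x != 0 ->
  exists2 f : {linear X -> R^o}, continuous f & f x != 0.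
Proof.
move=> x0.
(* Lowering the norm along [x] before minimizing forces [q (- x) <= - |x|], which makes the
   functional nonzero at [x]. *)
have [q [gq qx qmin]] := minimal_gauge (gauge_gauge_step x gauge_normr).
have qD y z : q (y + z) = q y + q z.
  apply: le_anti; have [-> _ _] /= := gq.
  (* By minimality the step along [z] changes nothing; the parameter value [1] then gives
     [q y <= q (y + z) - q z]. *)
  have stepz := qmin _ (gauge_gauge_step z gq) (fun y => gauge_step_le_id z y gq).
  have := gauge_step_le z y gq ler01.
  by rewrite stepz scale1r mul1r lerBrDr.
have qN y : q (- y) = - q y.
  by apply/eqP; rewrite -addr_eq0 -qD addNr gauge0.
have qlin : linear_for *%R q.
  move=> t y z; rewrite qD; congr (_ + _).
  have [t0|t0] := leP 0 t; first exact: gaugeZ.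
  by rewrite -[t]opprK scaleNr qN gaugeZ ?mulNr// oppr_ge0 ltW.
pose f : {linear X -> R^o} := HB.pack q (GRing.isLinear.Build R X R^o *:%R q qlin).
exists f.
  apply/linear_bounded_continuous/linear_boundedP; near=> r => y.
  apply: (@le_trans _ _ `|y|).
    by rewrite ler_norml gauge_norm_ge//=; case: gq.
  by rewrite ler_peMl//; near: r; exact: nbhs_pinfty_ge.
have := le_trans (qx (- x)) (gauge_step_le x (- x) gauge_normr ler01).
rewrite scale1r addNr normr0 mul1r sub0r qN lerN2 => xq.
by rewrite /= gt_eqF// (lt_le_trans _ xq)// normr_gt0.
Unshelve. all: by end_near. Qed.
End minimal_gauge.

(** * Operator norms of continuous linear maps *)
Section operator_norm.
Context (R : realType).
Implicit Types (V W X : normedModType R).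

Lemma unit_ballE X : unit_ball X = [set x | `|x| <= 1].
Proof.
rewrite /unit_ball closed_ballE//; apply/seteqP; split=> x /=;
  by rewrite /closed_ball_/= sub0r normrN.
Qed.

Lemma continuous_linear_bound V W (f : {linear V -> W}) : continuous f ->
  exists2 M, 0 < M & forall x, `|f x| <= M * `|x|.
Proof.
by move=> /linear_bounded_continuous/linear_boundedP/pinfty_ex_gt0[M]; exists M.
Qed.

Section bounded_on_ball.
Context V W (g : V -> W) (M : R) (gM : forall x, `|x| <= 1 -> `|g x| <= M).

Let g_has_sup : has_sup [set `|g x| | x in unit_ball V].
Proof.
rewrite unit_ballE; split; first by exists `|g 0|, 0; rewrite //= normr0.
by exists M => _ [x /= x1 <-]; exact: gM.
Qed.

(** The map [g] is arbitrary because [fun x => x + T x] in the Daugavet equation is a plain function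
    without a linear structure. *)
Lemma le_opnorm_ball x : `|x| <= 1 -> `|g x| <= opnorm g.
Proof.
move=> x1; apply: ub_le_sup; first by case: g_has_sup.
by exists x => //; rewrite unit_ballE.
Qed.

Lemma opnorm_le : opnorm g <= M.
Proof.
apply: ge_sup; first by case: g_has_sup.
by rewrite unit_ballE => _ [x /= x1 <-]; exact: gM.
Qed.

Lemma opnorm_adherent e :
  0 < e -> exists2 x, `|x| <= 1 & opnorm g - e < `|g x|.
Proof.
move=> /sup_adherent /(_ g_has_sup)[_ [x + <-] ?]; rewrite unit_ballE => x1.
by exists x.
Qed.
End bounded_on_ball.

Section continuous_linear.
Context V W (f : {linear V -> W}) (fc : continuous f).

Let f_bounded : exists M, forall x, `|x| <= 1 -> `|f x| <= M.
Proof.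
have [M M0 fM] := continuous_linear_bound fc.
exists M => x x1; apply: le_trans (fM x) _.
by rewrite ler_piMr// ltW.
Qed.

Lemma le_opnorm x : `|f x| <= opnorm f * `|x|.
Proof.
have [->|x0] := eqVneq x 0; first by rewrite linear0 !normr0 mulr0.
have [M fM] := f_bounded.
have x0' : 0 < `|x| by rewrite normr_gt0.
have := @le_opnorm_ball _ _ f M fM (`|x|^-1 *: x).
rewrite linearZ/= !normrZ normfV normr_id mulVf ?normr_eq0// lexx => /(_ isT).
by rewrite ler_pdivrMl// mulrC.
Qed.

Lemma opnorm_continuous_adherent e :
  0 < e -> exists2 x, `|x| <= 1 & opnorm f - e < `|f x|.
Proof. by have [M fM] := f_bounded; exact: opnorm_adherent fM _. Qed.
End continuous_linear.

Lemma dual_normalize X (f : {linear X -> R^o}) x : continuous f -> f x != 0 ->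
  0 < opnorm f /\
  exists2 g, dual_sphere X g & forall x, f x = opnorm f * g x.
Proof.
move=> fc fx0; set m := opnorm f.
have m0 : 0 < m.
  rewrite -(@pmulr_lgt0 _ `|x|).
    by apply: lt_le_trans (le_opnorm fc x); rewrite normr_gt0.
  by rewrite normr_gt0; apply: contraNneq fx0 => ->; rewrite linear0.
split=> //; pose g : {linear X -> R^o} := m^-1 \*: f.
have fE y : f y = m * g y.
  by rewrite /g /= /GRing.scale/= mulrA mulfV ?gt_eqF ?mul1r.
exists g => //.
have g1 y : `|g y| <= `|y|.
  rewrite -(ler_pM2l m0) -{1}(gtr0_norm m0) -normrM -fE.
  exact: le_opnorm.
have gc : continuous g.
  apply/linear_bounded_continuous/linear_boundedP; near=> r => y.
  apply: le_trans (g1 y) _.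
  by rewrite ler_peMl//; near: r; exact: nbhs_pinfty_ge.
split=> //; apply: le_anti; apply/andP; split.
  by apply: opnorm_le => y y1; exact: le_trans (g1 y) y1.
rewrite -(ler_pM2l m0) mulr1; apply: (@opnorm_le _ _ f) => y y1.
rewrite fE normrM (gtr0_norm m0) ler_pM2l//.
apply: le_trans (le_opnorm gc y) _.
rewrite ler_piMr//; apply: le_trans (normr_ge0 (g 0)) _.
by apply: (@le_opnorm_ball _ _ g 1) => [z|]; [exact: le_trans (g1 z)|rewrite normr0].
Unshelve. all: by end_near. Qed.

End operator_norm.

(** * The Daugavet property on slices and weak neighborhoods *)
Section daugavet.
Context (R : realType) (X : normedModType R) (X_daugavet : daugavet_property X).

Lemma daugavet_slice (f : {linear X -> R^o}) (y : X) (e : R) :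
  dual_sphere X f -> y != 0 -> 0 < e ->
  exists x, [/\ `|x| <= 1, 1 - e < f x & 1 + `|y| - e < `|x - y|].
Proof.
move=> [fc f1] y0 e0.
have ny0 : 0 < `|y| by rewrite normr_gt0.
(* If [|x - f x y|] nearly attains [1 + |y|], then [|f x|] is nearly [1], so up to
   the sign of [x] the vector [f x y] is nearly [y]. *)
pose t (x : X) : X := - (f x *: y).
have tlin : linear_for *:%R t.
  by move=> c u v; rewrite /t linearP scalerDl opprD scalerN scalerA.
pose T : {linear X -> X} := HB.pack t (GRing.isLinear.Build R X X *:%R t tlin).
have fN x : `|f x| <= `|x| by rewrite -[leRHS]mul1r -f1; exact: le_opnorm.
have TN x : `|T x| <= `|y| * `|x|.
  by rewrite /= normrN normrZ mulrC ler_wpM2l.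
have Tb : bounded_near T (nbhs 0).
  apply/linear_boundedP; near=> r => x.
  apply: le_trans (TN x) _.
  by rewrite ler_wpM2r//; near: r; exact: nbhs_pinfty_ge.
have T1 : rank_one T.
  exists y => //; apply/seteqP; split=> [_ [x _ <-]|_ [c _ <-]].
    by exists (- f x) => //=; rewrite scaleNr.
  have [x _] := opnorm_continuous_adherent fc ltr01.
  rewrite f1 subrr normr_gt0 => fx0; exists (- (c / f x) *: x) => //=.
  have fE : f (- (c / f x) *: x) = - c by rewrite linearZ/= /GRing.scale/= mulNr divfK.
  by rewrite /t fE scaleNr opprK.
have TM x : `|x| <= 1 -> `|T x| <= `|y|.
  by move=> x1; apply: le_trans (TN x) _; rewrite ler_piMr// ltW.
have oT : opnorm T = `|y|.
  apply: le_anti; rewrite opnorm_le//=.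
  apply/ler_addgt0Pr => d d0.
  have dy0 : 0 < d / `|y| by rewrite divr_gt0.
  have [x x1] := opnorm_continuous_adherent fc dy0.
  rewrite f1 ltrBlDr -(ltr_pM2r ny0) mul1r mulrDl divfK ?gt_eqF// -normrZ.
  move=> /ltW/le_trans; apply; rewrite lerD2r.
  by have := le_opnorm_ball TM x1; rewrite /= /t normrN.
have := X_daugavet Tb T1; rewrite oT => dT.
(* The bound [e * |y| / 2] yields [|f x| > 1 - e / 2]. The bound [e / 2] pays twice: for nearly
   attaining the norm, and for replacing [f x *: y] by [y]. *)
pose d := Num.min (e / 2) (e * `|y| / 2).
have d0 : 0 < d by rewrite lt_min !divr_gt0//= mulr_gt0.
have de : d <= e / 2 by rewrite ge_min lexx.
have dy : d <= e * `|y| / 2 by rewrite ge_min lexx orbT.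
have ITN x : `|x| <= 1 -> `|x + T x| <= 1 + `|y|.
  by move=> x1; apply: le_trans (ler_normD _ _) (lerD x1 (TM _ x1)).
have [x x1] := opnorm_adherent ITN d0.
rewrite dT /= /t => xd.
have fx1 : `|f x| <= 1 by exact: le_trans x1.
have fxy : `|y| - d < `|f x| * `|y|.
  have := ler_normB x (f x *: y); rewrite normrZ.
  by lra.
have fxe : 1 - e / 2 < `|f x|.
  rewrite -(ltr_pM2r ny0); apply: le_lt_trans fxy; lra.
have key z : `|z| <= 1 -> f z = `|f x| -> `|z - f z *: y| = `|x - f x *: y| ->
    [/\ `|z| <= 1, 1 - e < f z & 1 + `|y| - e < `|z - y|].
  move=> z1 fz zE; split=> //; first by rewrite fz; lra.
  have := ler_normD (z - y) (y - f z *: y).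
  have yE : y - f z *: y = (1 - f z) *: y by rewrite scalerBl scale1r.
  rewrite addrA subrK zE yE normrZ fz.
  rewrite (@ger0_norm _ (1 - _)) ?subr_ge0//; lra.
have [fx0|fx0] := leP 0 (f x); first by exists x; apply: key; rewrite ?ger0_norm.
exists (- x); apply: key; rewrite ?normrN ?linearN ?ltr0_norm//.
by rewrite scaleNr -opprD normrN.
Unshelve. all: by end_near. Qed.

(** Rescaling by [r] reduces this to a slice of the unit ball: [f a] is at most [opnorm f * r], so
    the half-space contains a thin slice of the [r]-ball. The degenerate cases [y = 0], [f = 0] and
    [r = 0] are settled separately. *)
Lemma daugavet_halfspace (f : {linear X -> R^o}) (a y : X) (r h e : R) :
  (exists x : X, x != 0) -> continuous f -> `|a| <= r -> 0 < h -> 0 < e ->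
  exists u, [/\ `|u| <= r, f a - h <= f u & r + `|y| - e <= `|u - y|].
Proof.
move=> [x0 x00] fc ar h0 e0.
(* For [y = 0], the nonzero case is applied to a vector of norm [e / 2]. *)
wlog y0 : y e e0 / y != 0.
  move=> H; have [y0|] := eqVneq y 0; last exact: H.
  have nx0 : 0 < `|x0| by rewrite normr_gt0.
  have e20 : 0 < e / 2 by rewrite divr_gt0.
  pose z := (e / 2 / `|x0|) *: x0.
  have nz : `|z| = e / 2.
    by rewrite normrZ ger0_norm ?divfK ?gt_eqF ?divr_ge0 ?ltW.
  have z0 : z != 0 by rewrite -normr_gt0 nz.
  have [u [ur fu uz]] := H z _ e20 z0; exists u; split=> //.
  by have := ler_normB u z; rewrite y0 subr0 normr0; lra.
have ny0 : 0 < `|y| by rewrite normr_gt0.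
have r0 : 0 <= r by apply: le_trans ar.
have [fx|f0] := pselect (exists x, f x != 0); last first.
  have {}f0 x : f x = 0 by apply/eqP/negP => /negP fx; apply: f0; exists x.
  exists (- (r / `|y|) *: y); split.
  - by rewrite normrZ normrN ger0_norm ?divfK ?gt_eqF// divr_ge0.
  - by rewrite !f0; lra.
  - have -> : - (r / `|y|) *: y - y = - ((r / `|y| + 1) *: y).
      by rewrite scalerDl scale1r opprD scaleNr.
    rewrite normrN normrZ ger0_norm ?addr_ge0 ?divr_ge0//.
    by rewrite mulrDl divfK ?gt_eqF// mul1r; lra.
have [x fx0] := fx.
have [m0 [g gS fE]] := dual_normalize fc fx0.
move: r0; rewrite le_eqVlt => /predU1P[r0|r0].
  have a0 : a = 0 by apply/eqP; rewrite -normr_le0 r0.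
  by exists 0; split; rewrite ?normr0 ?a0 -?r0// ?sub0r ?normrN; lra.
pose m := opnorm f.
(* After scaling by [r], the loss [d] becomes [d * r <= e] in the distance and [d * (m * r) <= h] in
   the value of [f]. *)
pose d := Num.min (e / r) (h / (m * r)).
have d0 : 0 < d by rewrite lt_min !divr_gt0// mulr_gt0.
have de : d * r <= e by rewrite -ler_pdivlMr// ge_min lexx.
have dh : d * (m * r) <= h by rewrite -ler_pdivlMr ?mulr_gt0// ge_min lexx orbT.
have ry0 : r^-1 *: y != 0 by rewrite scaler_eq0 invr_eq0 gt_eqF.
have [u [u1 gu uy]] := daugavet_slice gS ry0 d0.
exists (r *: u); split.
- by rewrite normrZ gtr0_norm// ler_piMr// ltW.
- rewrite linearZ/= /GRing.scale/= !fE -/m.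
  have : g a <= r.
    apply: le_trans (ler_norm _) _; apply: le_trans ar.
    by case: gS => gc g1; rewrite -[leRHS]mul1r -g1; exact: le_opnorm.
  rewrite -(ler_pM2l m0) -/m => ga.
  have : m * r * (1 - d) <= m * r * g u by rewrite ler_pM2l ?mulr_gt0// ltW.
  by rewrite mulrBr; lra.
- have -> : r *: u - y = r *: (u - r^-1 *: y).
    by rewrite scalerBr scalerA mulfV ?gt_eqF// scale1r.
  rewrite normrZ (gtr0_norm r0); apply: le_trans (ler_wpM2l (ltW r0) (ltW uy)).
  rewrite normrZ normfV (gtr0_norm r0) mulrBr mulrDr mulr1 mulrA mulfV ?gt_eqF//.
  by rewrite mul1r; lra.
Qed.
End daugavet.

Section daugavet_weak_neighborhoods.
Context (R : realType) (X : normedModType R).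
Context (X_daugavet : daugavet_property X) (X_nontrivial : exists x : X, x != 0).

Lemma continuous_linear_bounds k (f : 'I_k -> {linear X -> R^o}) :
  (forall j, continuous (f j)) ->
  exists M : 'I_k -> R, forall j, 0 < M j /\ forall x, `|f j x| <= M j * `|x|.
Proof.
move=> fc.
suff /choice[M fM] : forall j, exists m,
    0 < m /\ forall x, `|f j x| <= m * `|x| by exists M.
by move=> j; have [M] := continuous_linear_bound (fc j); exists M.
Qed.

Lemma linear_combination k (f : 'I_k -> {linear X -> R^o}) (c : 'I_k -> R) :
  (forall j, continuous (f j)) ->
  exists2 g : {linear X -> R^o}, continuous g &
    forall x, g x = \sum_j c j * f j x.
Proof.
move=> fc; pose g x : R := \sum_j c j * f j x.
have glin : linear_for *%R g.
  move=> t x y; rewrite /g mulr_sumr -big_split/=; apply: eq_bigr => j _.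
  by rewrite linearP/= /GRing.scale/= mulrDr mulrCA.
exists (HB.pack g (GRing.isLinear.Build R X R^o *:%R g glin) : {linear X -> R^o}) => //.
have [M fM] := continuous_linear_bounds fc.
apply/linear_bounded_continuous/linear_boundedP; near=> r => x.
apply: (@le_trans _ _ (\sum_j `|c j| * M j * `|x|)).
  apply: le_trans (ler_norm_sum _ _ _) _; apply: ler_sum => j _.
  by rewrite normrM -mulrA ler_wpM2l//; have [_] := fM j.
by rewrite -mulr_suml ler_wpM2r//; near: r; exact: nbhs_pinfty_ge.
Unshelve. all: by end_near. Qed.

(** Controls the quadratic part of the change of the squared error when one point of the [r]-ball is
    added. *)
Lemma linear_ball_osc k (f : 'I_k -> {linear X -> R^o}) (r : R) :
  0 <= r -> (forall j, continuous (f j)) ->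
  exists2 D, 0 <= D & forall u v, `|u| <= r -> `|v| <= r ->
    \sum_j (f j u - f j v) ^+ 2 <= D.
Proof.
move=> r0 fc.
have [M fM] := continuous_linear_bounds fc.
exists (\sum_j (M j * (r + r)) ^+ 2); first by apply: sumr_ge0 => j _; exact: sqr_ge0.
move=> u v ur vr; apply: ler_sum => j _; have [M0 {}fM] := fM j.
rewrite -linearB -real_normK ?num_real// ler_sqr ?nnegrE// ?mulr_ge0 ?addr_ge0 ?(ltW M0)//.
apply: le_trans (fM _) _; rewrite ler_pM2l//.
by apply: le_trans (ler_normB _ _) _; exact: lerD.
Qed.

(* Each new summand [u] is taken in the half-space where the linear part of the
   change of the squared error is at most [2], so the squared error of the sum
   grows linearly in [n], and that of the average tends to [0]. *)
Lemma daugavet_greedy_sum k (f : 'I_k -> {linear X -> R^o}) (a : X) (r e : R) :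
  (forall j, continuous (f j)) -> `|a| <= r -> 0 < e ->
  exists2 D, 0 <= D & forall n z, exists s, [/\ `|s| <= r *+ n,
    \sum_j (f j s - f j a *+ n) ^+ 2 <= D *+ n &
    `|z| + (r - e) *+ n <= `|s - z|].
Proof.
move=> fc ar e0; have r0 : 0 <= r by exact: le_trans ar.
have [D D0 fD] := linear_ball_osc r0 fc.
exists (D + 2); first by rewrite addr_ge0.
move=> n z; elim: n => [|n [s [sr sf sz]]].
  exists 0; rewrite normr0 mulr0n; split=> //; last by rewrite mulr0n addr0 sub0r normrN.
  by rewrite big1// => j _; rewrite linear0 mulr0n subr0 expr0n.
pose c j := f j s - f j a *+ n.
have [g gc gE] := linear_combination (fun j => - c j) fc.
(* The new point is far from [z - s], what remains of [z]. The slack [1] in the half-space gives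
   [g a - g u <= 1], whence the [2] in [D + 2]. *)
have [u [ur gu uz]] := daugavet_halfspace X_daugavet (z - s) X_nontrivial gc ar ltr01 e0.
exists (s + u); split.
- by rewrite mulrSr; apply: le_trans (ler_normD _ _) _; exact: lerD.
- have -> : \sum_j (f j (s + u) - f j a *+ n.+1) ^+ 2 =
      \sum_j c j ^+ 2 + 2 * (g a - g u) + \sum_j (f j u - f j a) ^+ 2.
    rewrite !gE -sumrB mulr_sumr -!big_split/=; apply: eq_bigr => j _.
    by rewrite linearD mulrSr /c/=; ring.
  rewrite mulrSr; have := fD _ _ ur ar.
  by rewrite -/c in sf *; lra.
- have -> : s + u - z = u - (z - s) by rewrite opprB addrA [u + s]addrC.
  rewrite distrC in sz; apply: le_trans uz; rewrite mulrSr. lra.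
Qed.

(** Dividing a greedy sum of [n] points, built against [n%:R *: y], by [n] leaves a squared error of
    at most [D / n], which is below [h ^+ 2] for large [n], while the loss in distance averages to
    [e]. *)
Lemma daugavet_weak_neighborhood k (f : 'I_k -> {linear X -> R^o}) (a y : X)
    (r h e : R) :
  (forall j, continuous (f j)) -> `|a| <= r -> 0 < h -> 0 < e ->
  exists u, [/\ `|u| <= r, forall j, `|f j u - f j a| < h &
    r + `|y| - e <= `|u - y|].
Proof.
move=> fc ar h0 e0.
have [D D0 sumD] := daugavet_greedy_sum fc ar e0.
pose n := (Num.truncn (D / h ^+ 2)).+1.
have n0 : 0 < n%:R :> R by rewrite ltr0n.
have nD : D < n%:R * h ^+ 2.
  by rewrite -ltr_pdivrMr ?exprn_gt0//; exact: truncnS_gt.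
have [s [sr sf sy]] := sumD n (n%:R *: y).
have nV (x : X) : `|n%:R^-1 *: x| = n%:R^-1 * `|x|.
  by rewrite normrZ ger0_norm// invr_ge0 ltW.
exists (n%:R^-1 *: s); split.
- by rewrite nV ler_pdivrMl// mulr_natl.
- move=> j; have -> : f j (n%:R^-1 *: s) - f j a = n%:R^-1 * (f j s - f j a *+ n).
    by rewrite linearZ/= /GRing.scale/= mulrBr -[f j a *+ n]mulr_natl mulKf ?gt_eqF.
  rewrite normrM gtr0_norm ?invr_gt0// ltr_pdivrMl//.
  have nh0 : 0 <= n%:R * h by rewrite mulr_ge0// ltW.
  rewrite -ltr_sqr ?nnegrE// (real_normK (num_real (f j s - f j a *+ n : R))).
  apply: (@le_lt_trans _ _ (D *+ n)).
    apply: le_trans sf; rewrite (bigD1 j)//= lerDl.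
    by apply: sumr_ge0 => i _; exact: sqr_ge0.
  by rewrite -[D *+ n]mulr_natl exprMn [n%:R ^+ 2]expr2 -mulrA ltr_pM2l.
- have -> : n%:R^-1 *: s - y = n%:R^-1 *: (s - n%:R *: y).
    by rewrite scalerBr scalerA mulVf ?gt_eqF// scale1r.
  rewrite nV ler_pdivlMl//; apply: le_trans sy.
  rewrite normrZ gtr0_norm// -[(r - e) *+ n]mulr_natl; lra.
Qed.

End daugavet_weak_neighborhoods.

(** Induction on [n]: the first point is chosen far from [y] after rescaling, the others far from
    the remainder [y - l ord0 *: u0], so the distances accumulate. Each of the two choices spends
    half of [e]. *)
Lemma convex_combination_far (R : realType) (X : normedModType R) n
    (l r : 'I_n -> R) (A : 'I_n -> set X) :
  (forall i, 0 <= l i) ->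
  (forall i y e, 0 < e -> exists2 u, A i u & r i + `|y| - e <= `|u - y|) ->
  forall y e, 0 < e -> exists2 u : 'I_n -> X, forall i, A i (u i) &
    \sum_i l i * r i + `|y| - e <= `|\sum_i l i *: u i - y|.
Proof.
elim: n l r A => [|n IH] l r A l0 Afar y e e0.
  by exists (fun=> 0) => [[]//|]; rewrite !big_ord0 sub0r normrN; lra.
have e20 : 0 < e / 2 by rewrite divr_gt0.
have [u0 Au0 u0y] : exists2 u, A ord0 u &
    l ord0 * r ord0 + `|y| - e / 2 <= `|l ord0 *: u - y|.
  have := l0 ord0; set t := l ord0; rewrite le_eqVlt => /predU1P[<-|t0].
    (* With weight [0] any point of the set will do; the far-point hypothesis is used only to
       produce one. *)
    have [u Au _] := Afar ord0 0 _ ltr01; exists u => //.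
    by rewrite scale0r mul0r sub0r normrN; lra.
  have [u Au uy] := Afar ord0 (t^-1 *: y) _ (divr_gt0 e20 t0); exists u => //.
  have -> : t *: u - y = t *: (u - t^-1 *: y).
    by rewrite scalerBr scalerA mulfV ?gt_eqF// scale1r.
  rewrite normrZ (gtr0_norm t0); apply: le_trans (ler_wpM2l (ltW t0) uy).
  rewrite normrZ normfV (gtr0_norm t0) mulrBr mulrDr mulrA mulfV ?gt_eqF//.
  by rewrite mul1r mulrCA mulfV ?gt_eqF// mulr1.
have [u Au uy] := IH (l \o lift ord0) (r \o lift ord0) (A \o lift ord0)
  (fun i => l0 _) (fun i => Afar _) (y - l ord0 *: u0) _ e20.
exists (fun i => if unlift ord0 i is Some j then u j else u0).
  by move=> i; case: unliftP => [j|] ->; [exact: Au|].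
rewrite !big_ord_recl unlift_none.
under [X in `|_ + X - _|]eq_bigr => i _ do rewrite liftK.
set s := \sum_(i < n) _ in uy *; set S := \sum_(i < n) _ in uy *.
have -> : l ord0 *: u0 + S - y = S - (y - l ord0 *: u0).
  by rewrite opprB addrA [S + _]addrC.
by apply: le_trans uy; rewrite /s/= (distrC y); lra.
Qed.

(** * Weakly open sets *)
Section weak_topology.
Context (R : realType) (X : normedModType R).

(** A concrete form of the weak neighborhoods of [a]: finitely many functionals with one common
    tolerance. *)
Definition weak_base (a : X) : set_system X := [set A |
  exists (k : nat) (f : 'I_k -> {linear X -> R^o}) (h : R),
    [/\ forall j, continuous (f j), 0 < h &
        forall x, (forall j, `|f j x - f j a| < h) -> A x]].

Lemma weak_base_filter a : Filter (weak_base a).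
Proof.
split.
- by exists 0, (fun=> \0), 1; split=> // [[]].
- move=> A B [k [f [h [fc h0 fA]]]] [m [g [t [gc t0 gB]]]].
  exists (k + m)%N, (fun j => match fintype.split j with inl i => f i | inr i => g i end).
  exists (Num.min h t); split=> [j||x fgx].
  + by case: (fintype.split j).
  + by rewrite lt_min h0.
  + split; [apply: fA => j; have := fgx (unsplit (inl j))|
            apply: gB => j; have := fgx (unsplit (inr j))];
      by rewrite unsplitK lt_min => /andP[].
- move=> A B AB [k [f [h [fc h0 fA]]]]; exists k, f, h; split=> // x /fA; exact: AB.
Qed.

(** It is enough that the filter [weak_base a] converges to [a] in the supremum topology, that is,
    in each initial topology; there a single functional suffices. *)
Lemma weakly_open_weak_base (U : set X) a : weakly_open U -> U a -> weak_base a U.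
Proof.
move=> Uo Ua.
have FF := weak_base_filter a.
have H : weak_base a --> (a : weak X).
  apply/cvg_sup => - [f fc] A /=.
  rewrite (@nbhsE (initial_topology (f : X -> R^o))).
  move=> [_ [[V Vo <-] Va] VA].
  have /nbhs_ballP[h /= h0 hV] : nbhs (f a : R^o) V by exact: open_nbhs_nbhs.
  exists 1, (fun=> f), h; split=> // x fx; apply: VA; apply: hV.
  by rewrite -ball_normE/= distrC; exact: (fx ord0).
by apply: H; apply: open_nbhs_nbhs.
Qed.

Lemma weakly_open_halfspace (f : {linear X -> R^o}) c : continuous f ->
  weakly_open [set x | c < f x].
Proof.
move=> fc; rewrite /weakly_open openE => x /= cx.
have /cvg_sup H : nbhs (x : weak X) --> (x : weak X) by exact: cvg_id.
apply: (H (exist _ f fc)) => /=.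
rewrite (@nbhsE (initial_topology (f : X -> R^o))).
exists [set x | c < f x] => //; split=> //.
by exists [set y | c < y] => //; exact: open_gt.
Qed.

End weak_topology.

(** * Geometry of the p-sum *)
Section powers.
Context (R : realType) (p : R) (p1 : 1 < p).
Implicit Types a b : R.

Let p_gt0 : 0 < p. Proof. exact: lt_trans p1. Qed.

Lemma ler_powR_base a b : 0 <= a -> 0 <= b -> (a `^ p <= b `^ p) = (a <= b).
Proof.
move=> a0 b0; apply/idP/idP => [|ab]; last first.
  by apply: ge0_ler_powR; rewrite ?nnegrE// ltW.
by apply: contraTT; rewrite -!ltNge => ?; apply: gt0_ltr_powR; rewrite ?nnegrE.
Qed.

Lemma powR_invK a : 0 <= a -> (a `^ p^-1) `^ p = a.
Proof. by move=> a0; rewrite -powRrM mulVf ?gt_eqF// powRr1. Qed.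

Lemma powR_root a : 0 <= a -> exists2 b, 0 <= b & b `^ p = a.
Proof. by move=> a0; exists (a `^ p^-1); [exact: powR_ge0|exact: powR_invK]. Qed.

Lemma powR_le1 a : 0 <= a -> (a `^ p <= 1) = (a <= 1).
Proof. by move=> a0; rewrite -(ler_powR_base a0 ler01) powR1. Qed.

(** Both numbers are at most [1], so raising them to the power [p] does not increase them. *)
Lemma powR_sum1 a b : 0 <= a -> 0 <= b -> a `^ p + b `^ p = 1 -> 1 <= a + b.
Proof.
have le1 c d : 0 <= c -> c `^ p + d `^ p = 1 -> c `^ p <= c.
  rewrite le_eqVlt => /predU1P[<-|c0 cd]; first by rewrite powR0 ?gt_eqF.
  apply: ge1r_powR; last exact: ltW.
  rewrite c0/= -ler_powR_base ?(ltW c0)// powR1.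
  by rewrite -cd lerDl powR_ge0.
move=> a0 b0 ab; rewrite -ab lerD//; first exact: le1 ab.
by apply: (le1 _ a) => //; rewrite addrC.
Qed.

Lemma powR_midpoint a b : 0 <= a -> 0 <= b ->
  2 * ((a + b) / 2) `^ p <= a `^ p + b `^ p.
Proof.
move=> a0 b0.
have h0 : 0 <= 2^-1 :> R by lra.
have h1 : 2^-1 <= 1 :> R by lra.
have : (2^-1 * a + (1 - 2^-1) * b) `^ p <= 2^-1 * a `^ p + (1 - 2^-1) * b `^ p.
  have := @convex_powR R p (ltW p1) (Itv01 h0 h1) a b.
  by rewrite /= !inE /= !in_itv /= !andbT => /(_ a0 b0).
have -> : 1 - 2^-1 = 2^-1 :> R by lra.
by rewrite -!mulrDr [2^-1 * (a + b)]mulrC ler_pdivlMl.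
Qed.
End powers.

Section psum_geometry.
Context (R : realType) (p : R) (p1 : 1 < p) (X Y : normedModType R).
Local Notation Z := (psum p1 X Y).
Implicit Types z : Z.

Let p_gt0 : 0 < p. Proof. exact: lt_trans p1. Qed.

Lemma psum_norm_powR z : `|z| `^ p = `|z.1| `^ p + `|z.2| `^ p.
Proof. by rewrite psum_normE powR_invK// addr_ge0// powR_ge0. Qed.

Lemma psum_norm_le z t : 0 <= t ->
  (`|z| <= t) = (`|z.1| `^ p + `|z.2| `^ p <= t `^ p).
Proof. by move=> t0; rewrite -(ler_powR_base p1)// psum_norm_powR. Qed.

Lemma psum_norm_inl (x : X) : `|((x, 0) : Z)| = `|x|.
Proof.
by rewrite psum_normE/= normr0 powR0 ?gt_eqF// addr0 -powRrM mulfV ?gt_eqF// powRr1.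
Qed.

Lemma psum_norm_inr (y : Y) : `|((0, y) : Z)| = `|y|.
Proof.
by rewrite psum_normE/= normr0 powR0 ?gt_eqF// add0r -powRrM mulfV ?gt_eqF// powRr1.
Qed.

Lemma psum_norm_fst z : `|z.1| <= `|z|.
Proof. by rewrite -(ler_powR_base p1)// psum_norm_powR lerDl powR_ge0. Qed.




Lemma psum_norm_ge_sum z : 2 `^ p^-1 * ((`|z.1| + `|z.2|) / 2) <= `|z|.
Proof.
have s0 : 0 <= (`|z.1| + `|z.2|) / 2 by rewrite divr_ge0// addr_ge0.
rewrite -(ler_powR_base p1) ?mulr_ge0 ?powR_ge0// powRM ?powR_ge0//.
by rewrite powR_invK// psum_norm_powR; exact: powR_midpoint.
Qed.

Lemma psum_sphere_sum z : `|z| = 1 -> 1 <= `|z.1| + `|z.2|.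
Proof. by move=> z1; apply: (powR_sum1 p1) => //; rewrite -psum_norm_powR z1 powR1. Qed.

Lemma psum_sum_fst n (F : 'I_n -> Z) : (\sum_i F i).1 = \sum_i (F i).1.
Proof. by elim/big_rec2: _ => // i x z _ <-. Qed.

Lemma psum_sum_snd n (F : 'I_n -> Z) : (\sum_i F i).2 = \sum_i (F i).2.
Proof. by elim/big_rec2: _ => // i x z _ <-. Qed.

Lemma dual_inl (f : {linear Z -> R^o}) : continuous f ->
  exists2 g : {linear X -> R^o}, continuous g & forall x, g x = f (x, 0).
Proof.
move=> fc; pose g (x : X) : R := f (x, 0).
have glin : linear_for *%R g.
  move=> t x y; rewrite /g -[X in _ = X](linearP f); congr (f _).
  by congr pair; rewrite /= scaler0 addr0.
exists (HB.pack g (GRing.isLinear.Build R X R^o *:%R g glin) : {linear X -> R^o}) => //.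
have [M M0 fM] := continuous_linear_bound fc.
apply/linear_bounded_continuous/linear_boundedP; near=> r => x.
apply: (@le_trans _ _ (M * `|x|)); first by rewrite -psum_norm_inl; exact: fM.
by rewrite ler_wpM2r//; near: r; exact: nbhs_pinfty_ge.
Unshelve. all: by end_near. Qed.

Lemma dual_inr (f : {linear Z -> R^o}) : continuous f ->
  exists2 g : {linear Y -> R^o}, continuous g & forall y, g y = f (0, y).
Proof.
move=> fc; pose g (y : Y) : R := f (0, y).
have glin : linear_for *%R g.
  move=> t x y; rewrite /g -[X in _ = X](linearP f); congr (f _).
  by congr pair; rewrite /= scaler0 addr0.
exists (HB.pack g (GRing.isLinear.Build R Y R^o *:%R g glin) : {linear Y -> R^o}) => //.
have [M M0 fM] := continuous_linear_bound fc.
apply/linear_bounded_continuous/linear_boundedP; near=> r => y.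
apply: (@le_trans _ _ (M * `|y|)); first by rewrite -psum_norm_inr; exact: fM.
by rewrite ler_wpM2r//; near: r; exact: nbhs_pinfty_ge.
Unshelve. all: by end_near. Qed.

(** The norm stays [1]: the first projection is a contraction, and [x] embeds isometrically as
    [(x, 0)]. *)
Lemma dual_sphere_fst (g : {linear X -> R^o}) : dual_sphere X g ->
  exists2 f : {linear Z -> R^o}, dual_sphere Z f & forall z, f z = g z.1.
Proof.
move=> [gc g1]; pose f (z : Z) : R := g z.1.
have flin : linear_for *%R f by move=> t x y; rewrite /f/= linearP.
pose F : {linear Z -> R^o} := HB.pack f (GRing.isLinear.Build R Z R^o *:%R f flin).
have F1 z : `|F z| <= `|z|.
  by apply: le_trans (le_opnorm gc _) _; rewrite g1 mul1r psum_norm_fst.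
exists F => //; split.
  apply/linear_bounded_continuous/linear_boundedP; near=> r => z.
  apply: le_trans (F1 z) _.
  by rewrite ler_peMl//; near: r; exact: nbhs_pinfty_ge.
have FB z : `|z| <= 1 -> `|F z| <= 1 by exact: le_trans.
apply: le_anti; rewrite (opnorm_le FB)/= -g1; apply: opnorm_le => x x1.
by apply: (le_opnorm_ball FB (x := (x, 0))); rewrite psum_norm_inl.
Unshelve. all: by end_near. Qed.
End psum_geometry.

(** * Indices of thickness of the p-sum *)
(** For [A] inside the [r]-ball, [r + |y|] is the largest distance that the triangle inequality
    allows. *)
Definition daugavet_far (R : realType) (X : normedModType R) (A : set X) (r : R) :=
  forall y e, 0 < e -> exists2 u, A u & r + `|y| - e <= `|u - y|.

Section psum_thickness.
Context (R : realType) (p : R) (p1 : 1 < p) (X Y : normedModType R).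
Context (X_nontrivial : exists x : X, x != 0) (Y_nontrivial : exists y : Y, y != 0).
Context (X_daugavet : daugavet_property X) (Y_daugavet : daugavet_property Y).
Local Notation Z := (psum p1 X Y).

Lemma rel_weakly_open_rectangle (W : set Z) w : rel_weakly_open Z W -> W w ->
  exists (r s : R) (A : set X) (B : set Y),
    [/\ 1 <= r + s, daugavet_far A r, daugavet_far B s &
        forall u v, A u -> B v -> W (u, v)].
Proof.
move=> [U Uo ->]; rewrite unit_ballE => - [Uw /= w1].
have [k [f [h [fc h0 fU]]]] := weakly_open_weak_base Uo Uw.
have h20 : 0 < h / 2 by rewrite divr_gt0.
have /choice[fX fXE] : forall j, exists g : {linear X -> R^o},
    continuous g /\ forall x, g x = f j (x, 0).
  by move=> j; have [g] := dual_inl (fc j); exists g.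
have /choice[fY fYE] : forall j, exists g : {linear Y -> R^o},
    continuous g /\ forall y, g y = f j (0, y).
  by move=> j; have [g] := dual_inr (fc j); exists g.
have p0 : 0 < p by exact: lt_trans p1.
have w1p : `|w.1| `^ p + `|w.2| `^ p <= 1.
  by have := w1; rewrite psum_norm_le// powR1.
have q0 : 0 <= 1 - `|w.2| `^ p by have := powR_ge0 `|w.1| p; lra.
(* The first radius is enlarged from [|w.1|] until its [p]-th power and that of [|w.2|] add up to
   [1]. The rectangle stays in the unit ball, and the radii sum to at least [1] even if [w] has norm
   below [1]. *)
have [r r0 rp] := powR_root p1 q0.
have w1r : `|w.1| <= r by rewrite -(ler_powR_base p1)// rp; lra.
exists r, `|w.2|.
exists [set u | `|u| <= r /\ forall j, `|fX j u - fX j w.1| < h / 2].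
exists [set v | `|v| <= `|w.2| /\ forall j, `|fY j v - fY j w.2| < h / 2].
split.
- by apply: (powR_sum1 p1) => //; rewrite rp subrK.
- move=> y e e0.
  have [u [ur fu uy]] := daugavet_weak_neighborhood X_daugavet X_nontrivial y
    (fun j => proj1 (fXE j)) w1r h20 e0.
  by exists u.
- move=> y e e0.
  have [u [ur fu uy]] := daugavet_weak_neighborhood Y_daugavet Y_nontrivial y
    (fun j => proj1 (fYE j)) (lexx `|w.2|) h20 e0.
  by exists u.
- move=> u v [ur fu] [vs fv]; split; last first.
    rewrite /= psum_norm_le// powR1.
    have := ur; rewrite -(ler_powR_base p1)// rp => ur'.
    by have := vs; rewrite -(ler_powR_base p1)//=; lra.
  apply: fU => j.
  have fE (x : X) (y : Y) : f j (x, y) = fX j x + fY j y.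
    have [_ ->] := fXE j; have [_ ->] := fYE j; rewrite -linearD; congr (f j _).
    by congr pair; rewrite /= ?addr0 ?add0r.
  rewrite fE [w]surjective_pairing fE/= opprD addrACA.
  by apply: le_lt_trans (ler_normD _ _) _; rewrite [h]splitr ltrD.
Qed.

Lemma convex_combinations_far (C : set Z) z0 e :
  convex_combinations (rel_weakly_open Z) C -> C !=set0 ->
  `|z0| = 1 -> 0 < e ->
  exists2 c, C c & 2 `^ p^-1 * (1 - e) <= `|c - z0|.
Proof.
move=> [n [l [W [l01 l1 Wo ->]]]] [_ [w /= Ww _]] z01 e0.
have /choice[q qP] : forall i, exists q : (R * R) * (set X * set Y),
    [/\ 1 <= q.1.1 + q.1.2, daugavet_far q.2.1 q.1.1, daugavet_far q.2.2 q.1.2 &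
        forall u v, q.2.1 u -> q.2.2 v -> W i (u, v)].
  move=> i; have [r [s [A [B H]]]] := rel_weakly_open_rectangle (Wo i) (Ww i).
  by exists ((r, s), (A, B)).
have l0 i : 0 <= l i by have /andP[] := l01 i.
have [|u Au uz] := @convex_combination_far _ _ _ l (fun i => (q i).1.1)
  (fun i => (q i).2.1) l0 _ z0.1 _ e0.
  by move=> i; have [] := qP i.
have [|v Bv vz] := @convex_combination_far _ _ _ l (fun i => (q i).1.2)
  (fun i => (q i).2.2) l0 _ z0.2 _ e0.
  by move=> i; have [] := qP i.
pose c : Z := \sum_i l i *: ((u i, v i) : Z).
exists c.
  exists (fun i => (u i, v i)) => // i.
  by have [_ _ _] := qP i; apply.
(* The radii contribute at least [1] to the sum of the two coordinate distances, the components of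
   [z0] at least [1], and the losses are [2 * e]; half of this is [1 - e]. *)
apply: le_trans (psum_norm_ge_sum _); rewrite ler_wpM2l ?powR_ge0//.
have -> : (c - z0).1 = \sum_i l i *: u i - z0.1 by rewrite /= psum_sum_fst.
have -> : (c - z0).2 = \sum_i l i *: v i - z0.2 by rewrite /= psum_sum_snd.
have : 1 <= \sum_i l i * (q i).1.1 + \sum_i l i * (q i).1.2.
  rewrite -big_split/= -l1; apply: ler_sum => i _.
  by rewrite -mulrDr ler_peMr//; have [] := qP i.
by have := psum_sphere_sum z01; lra.
Qed.

Lemma slice_in_ball t : 2 `^ p^-1 < t ->
  exists2 z, unit_sphere Z z & exists2 S, slices Z S & S `<=` closed_ball z t.
Proof.
move=> t2; have p0 : 0 < p by exact: lt_trans p1.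
have t0 : 0 < t by apply: le_lt_trans t2; exact: powR_ge0.
have [x0 x00] := X_nontrivial; have [y0 y00] := Y_nontrivial.
have [g0 g0c g0x] := dual_neq0 x00.
have [_ [g gS _]] := dual_normalize g0c g0x.
have [f fS fE] := dual_sphere_fst p1 Y gS.
have tp : 2 < t `^ p.
  have := @gt0_ltr_powR R p p0 (2 `^ p^-1) t.
  by rewrite powR_invK// !nnegrE powR_ge0 (ltW t0) => /(_ isT isT t2).
have tp1 : 0 <= t `^ p - 1 by lra.
(* The first component contributes at most [1] to the [p]-th power of the distance, so the second
   may contribute [b]^ p = t [^ p - 1]. As [b > 1], there is room for [|z.2| <= h] around the unit
   vector [y]. *)
have [b b0 bp] := powR_root p1 tp1.
have b1 : 1 < b.
  by rewrite ltNge -(powR_le1 p1 b0) bp -ltNge; lra.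
have [h [h0 h1 hb]] : exists h, [/\ 0 < h, h <= 1 & 1 + h <= b].
  exists (Num.min (b - 1) 1); split; first by rewrite lt_min subr_gt0 b1 ltr01.
    by rewrite ge_min lexx orbT.
  by rewrite -lerBrDl ge_min lexx.
have hp1 : h `^ p <= 1 by rewrite (powR_le1 p1 (ltW h0)).
have hp0 : 0 < h `^ p by exact: powR_gt0.
have hp2 : 0 <= 1 - h `^ p by rewrite subr_ge0.
(* The threshold [s] solves [s]^ p + h [^ p = 1]: in the unit ball, a first component of norm at
   least [s] forces [|z.2| <= h]. *)
have [s s0 sp] := powR_root p1 hp2.
have s1 : s < 1.
  by rewrite ltNge -(ler_powR_base p1 ler01 s0) powR1 sp -ltNge gtrDl oppr_lt0.
pose y := `|y0|^-1 *: y0.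
have y1 : `|y| = 1 by rewrite normrZ normfV normr_id mulVf ?normr_eq0.
exists ((0, y) : Z); first by rewrite /= psum_norm_inr.
exists (slice f (1 - s)).
  by exists f => //; exists (1 - s) => //; rewrite subr_gt0.
move=> z; rewrite /slice unit_ballE => - [/= z1]; rewrite fE subKr => sz.
rewrite closed_ballE// /closed_ball_/= distrC psum_norm_le ?(ltW t0)//=.
have z1p : `|z.1| `^ p + `|z.2| `^ p <= 1 by have := z1; rewrite psum_norm_le// powR1.
have sz1 : s <= `|z.1|.
  case: gS => gc g1; apply: ltW; apply: lt_le_trans sz _.
  by apply: le_trans (ler_norm _) _; apply: le_trans (le_opnorm gc _) _; rewrite g1 mul1r.
have z2h : `|z.2| <= h.
  rewrite -(ler_powR_base p1) ?(ltW h0)//.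
  by have := sz1; rewrite -(ler_powR_base p1)// sp; lra.
have : `|z.2 - y| `^ p <= b `^ p.
  rewrite (ler_powR_base p1) ?powR_ge0//; apply: le_trans hb.
  by apply: le_trans (ler_normB _ _) _; rewrite y1 addrC lerD2l.
have := powR_ge0 `|z.2| p; rewrite subr0 bp; lra.
Qed.

(** One statement covers the three indices: the slices in [F] give the upper bound, and the far
    points in convex combinations give the lower bound. *)
Lemma thickness_psum (F : set (set Z)) : slices Z `<=` F ->
  F `<=` [set C | convex_combinations (rel_weakly_open Z) C /\ C !=set0] ->
  thickness F = 2 `^ p^-1.
Proof.
move=> sF Fc; rewrite /thickness; set T := [set r | _].
have c0 : 0 < 2 `^ p^-1 :> R by exact: powR_gt0.
have Tin t : 2 `^ p^-1 < t -> T t.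
  move=> ct; split; first exact: lt_trans ct.
  by have [z z1 [S /sF FS Sz]] := slice_in_ball ct; exists z => //; exists S.
have Tlb : lbound T (2 `^ p^-1).
  move=> r [r0 [z /= z1 [C /Fc[Cc C0] Cz]]].
  apply/ler_addgt0Pr => e e0.
  have [c /Cz] := convex_combinations_far Cc C0 z1 (divr_gt0 e0 c0).
  rewrite closed_ballE// /closed_ball_/= distrC => cr.
  by move=> /le_trans/(_ cr); rewrite mulrBr mulr1 mulrCA mulfV ?gt_eqF// mulr1 lerBlDr.
apply: le_anti; apply/andP; split.
  apply/ler_addgt0Pr => e e0; apply: ge_inf; first by exists (2 `^ p^-1).
  by apply: Tin; rewrite ltrDl.
by apply: lb_le_inf => //; exists (2 `^ p^-1 + 1); apply: Tin; rewrite ltrDl.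
Qed.
End psum_thickness.

(** * Inclusions between the three families of sets *)

Section slices_and_weakly_open_sets.
Context (R : realType) (X : normedModType R).

(** A slice is cut out by a weakly open half-space; it is nonempty because [f] has norm [1], nearly
    attained at some [x] or, after a change of sign, at [- x]. *)
Lemma slices_rel_weakly_open :
  slices X `<=` [set W | rel_weakly_open X W /\ W !=set0].
Proof.
move=> _ [f [fc f1] [a a0 ->]]; split.
  exists [set x | 1 - a < f x]; first exact: weakly_open_halfspace.
  by apply/seteqP; split=> x [].
have [x x1] := opnorm_continuous_adherent fc a0; rewrite f1 => fx.
have sliceP z : `|z| <= 1 -> f z = `|f x| -> slice f a z.
  by move=> z1 fz; split; [rewrite unit_ballE|rewrite /= fz].
have [fx0|fx0] := leP 0 (f x).
  by exists x; apply: sliceP; rewrite ?ger0_norm.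
by exists (- x); apply: sliceP; rewrite ?normrN// linearN ltr0_norm.
Qed.

Lemma rel_weakly_open_convex_combinations :
  [set W | rel_weakly_open X W /\ W !=set0] `<=`
  [set C | convex_combinations (rel_weakly_open X) C /\ C !=set0].
Proof.
move=> W [Wo W0]; split=> //; exists 1, (fun=> 1), (fun=> W); split=> //.
- by move=> _; rewrite ler01 lexx.
- by rewrite big_ord1.
- apply/seteqP; split=> [x Wx|_ [w /= Ww <-]].
    by exists (fun=> x) => //=; rewrite big_ord1 scale1r.
  by rewrite big_ord1 scale1r; exact: Ww.
Qed.
End slices_and_weakly_open_sets.

Theorem theorem2p6 (R : realType) (X Y : completeNormedModType R)
    (X_nontrivial : exists x : X, x != 0) (Y_nontrivial : exists y : Y, y != 0)
    (p : R) (p1 : 1 < p) :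
  daugavet_property X -> daugavet_property Y ->
  [/\ thickness_s (psum p1 X Y) = 2 `^ p^-1,
      thickness_w (psum p1 X Y) = 2 `^ p^-1 &
      thickness_cc (psum p1 X Y) = 2 `^ p^-1].
Proof.
move=> X_daugavet Y_daugavet; split; apply: thickness_psum => //.
- by move=> S /slices_rel_weakly_open/rel_weakly_open_convex_combinations.
- exact: slices_rel_weakly_open.
- exact: rel_weakly_open_convex_combinations.
- by move=> S /slices_rel_weakly_open/rel_weakly_open_convex_combinations.
Qed.
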